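(* Let $\mathcal{S}$ and $\mathcal{S}'$ be square-free staged trees that are statistically equivalent via a bijection $\varphi:\Lambda(\mathcal{S})\to\Lambda(\mathcal{S}')$ between their sets of root-to-leaf paths. Let $\alpha>0$, let $\mathcal{D}=(N_\lambda)_{\lambda\in\Lambda(\mathcal{S})}$ be a complete data sample on $\mathcal{S}$, and let $\mathcal{D}'$ be the corresponding sample on $\mathcal{S}'$, given by $N'_{\varphi(\lambda)}=N_\lambda$. Then $\mathrm{BDepu}(\mathcal{S},\mathcal{D};\alpha)=\mathrm{BDepu}(\mathcal{S}',\mathcal{D}';\alpha)$.
   Context: An event tree is a finite directed rooted tree whose edges are directed away from the root; nodes with no outgoing edges are leaves, all other nodes are situations. A staged tree $\mathcal{S}$ is an event tree together with a partition of its situations into stages $u_1,\dots,u_J$ such that all situations in $u_j$ have the same number $r_j$ of outgoing edges, these being labelled $1,\dots,r_j$ at each situation of $u_j$; the $k$-th edge of every situation in $u_j$ carries the same conditional transition probability $\theta_{jk}$. The staged tree model is the set of probability distributions on the set $\Lambda(\mathcal{S})$ of root-to-leaf paths obtained by choosing for each stage a probability vector $(\theta_{j1},\dots,\theta_{jr_j})$ (positive entries summing to 1) and giving each path the product of the probabilities on its edges. A staged tree is square-free if no two situations on the same root-to-leaf path lie in the same stage. Two staged trees $\mathcal{S},\mathcal{S}'$ are statistically equivalent via a bijection $\varphi:\Lambda(\mathcal{S})\to\Lambda(\mathcal{S}')$ if the model of $\mathcal{S}$ equals $\{p\circ\varphi : p \text{ in the model of } \mathcal{S}'\}$, i.e.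 they represent the same set of distributions. A complete data sample $\mathcal{D}$ assigns to each root-to-leaf path $\lambda$ a number $N_\lambda\ge 0$ of units that traversed it. For stage $u_j$, $n_{jk}$ is the total number of units whose path passes through the $k$-th outgoing edge of some situation in $u_j$, and $\overline{n}_j=\sum_{k=1}^{r_j}n_{jk}$. Given hyperparameters $\alpha_{jk}>0$ with $\overline{\alpha}_j=\sum_{k=1}^{r_j}\alpha_{jk}$, the BD-metric is $$\mathrm{BD}(\mathcal{S},\mathcal{D};\boldsymbol{\alpha})=\prod_{j=1}^{J}\left[\frac{\Gamma(\overline{\alpha}_j)}{\Gamma(\overline{\alpha}_j+\overline{n}_j)}\prod_{k=1}^{r_j}\frac{\Gamma(\alpha_{jk}+n_{jk})}{\Gamma(\alpha_{jk})}\right].$$ For an edge $e$, $\Lambda(e)$ denotes the set of root-to-leaf paths containing $e$. For an imaginary sample size $\alpha>0$, the BDepu score $\mathrm{BDepu}(\mathcal{S},\mathcal{D};\alpha)$ is the BD-metric with $$\alpha_{jk}=\frac{\alpha}{|\Lambda(\mathcal{S})|}\sum_{m=1}^{h_j}|\Lambda(e^m_{jk})|,$$ where $h_j$ is the number of situations in $u_j$ and $e^m_{jk}$ is the $k$-th outgoing edge of the $m$-th situation of $u_j$. *)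

(* Defs.v *)
From Stdlib Require Import Reals.
From mathcomp Require Import all_boot all_algebra.
From mathcomp Require Import Rstruct.
From Coquelicot Require Import Rbar Lim_seq.

Set Implicit Arguments.
Unset Strict Implicit.
Unset Printing Implicit Defensive.

Import GRing.Theory.
Local Open Scope ring_scope.

(* Gamma s = lim_{n -> oo} n! n^s / (s (s+1) ... (s+n)),  valid for s > 0. *)
Definition Gamma (s : R) : R :=
  real (Lim_seq (fun n : nat =>
     ((n`!)%:R * Rpower (n%:R) s) / \prod_(i < n.+1) (s + i%:R))).

(* A finite rooted tree; the outgoing edges of a node are its children,
   labelled 0,1,...,(#children - 1) by their position in the list. *)
Inductive tree : Type := Node of seq tree.

Fixpoint subt (t : tree) (a : seq nat) : option tree :=
  match a with
  | [::] => Some t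
  | k :: a' => let: Node cs := t in
               if (k < size cs)%N then subt (nth t cs k) a' else None
  end.

Definition nch (t : tree) (a : seq nat) : nat :=
  match subt t a with Some (Node cs) => size cs | None => 0%N end.

Fixpoint nodes (t : tree) : seq (seq nat) :=
  let: Node cs := t in
  [::] :: (fix aux (i : nat) (l : seq tree) : seq (seq nat) :=
             match l with
             | [::] => [::]
             | c :: l' => [seq i :: a | a <- nodes c] ++ aux i.+1 l'
             end) 0%N cs.

Definition situations (t : tree) : seq (seq nat) :=
  [seq a <- nodes t | (0 < nch t a)%N].

(* leaves; a root-to-leaf path is identified with the address of its leaf *)
Definition leaves (t : tree) : seq (seq nat) :=
  [seq a <- nodes t | nch t a == 0%N].

(* [stage] assigns to every situation the (label of the) stage containing it;
   the stages are the nonempty fibres of [stage] on the situations. *)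
Record staged_tree := StagedTree { stree : tree; stage : seq nat -> nat }.

Definition is_staged (S : staged_tree) : Prop :=
  forall a b, a \in situations (stree S) -> b \in situations (stree S) ->
    stage S a = stage S b -> nch (stree S) a = nch (stree S) b.

Definition paths (S : staged_tree) := leaves (stree S).

Definition stages (S : staged_tree) : seq nat :=
  undup [seq stage S a | a <- situations (stree S)].

Definition stage_sits (S : staged_tree) (j : nat) : seq (seq nat) :=
  [seq a <- situations (stree S) | stage S a == j].

(* r_j : common number of outgoing edges of situations in stage j *)
Definition rst (S : staged_tree) (j : nat) : nat :=
  nch (stree S) (nth [::] (stage_sits S j) 0).

(* The situation reached after i steps along path l is [take i l], and the
   (i+1)-th edge of l is its outgoing edge labelled [nth 0 l i]. *)
Definition square_free (S : staged_tree) : Prop :=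
  forall l, l \in paths S -> forall i i', (i < i')%N -> (i' < size l)%N ->
    stage S (take i l) != stage S (take i' l).

Definition valid_theta (S : staged_tree) (theta : nat -> nat -> R) : Prop :=
  forall j, j \in stages S ->
    (forall k, (k < rst S j)%N -> 0 < theta j k) /\
    \sum_(k < rst S j) theta j k = 1.

Definition path_prob (S : staged_tree) (theta : nat -> nat -> R)
    (l : seq nat) : R :=
  \prod_(i < size l) theta (stage S (take i l)) (nth 0%N l i).

(* p : distribution on Lambda(S) (values off Lambda(S) are irrelevant) *)
Definition in_model (S : staged_tree) (p : seq nat -> R) : Prop :=
  exists theta, valid_theta S theta /\
    forall l, l \in paths S -> p l = path_prob S theta l.

Definition is_path_bijection (S S' : staged_tree) (phi : seq nat -> seq nat)
  : Prop :=
  [/\ {in paths S &, injective phi},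
      forall l, l \in paths S -> phi l \in paths S' &
      forall l', l' \in paths S' -> exists2 l, l \in paths S & phi l = l'].

Definition stat_equiv (S S' : staged_tree) (phi : seq nat -> seq nat) : Prop :=
  is_path_bijection S S' phi /\
  forall p : seq nat -> R,
    in_model S p <->
    exists q, in_model S' q /\ forall l, l \in paths S -> p l = q (phi l).

(* data sample: N l = number of units that traversed path l *)

Definition through_edge (S : staged_tree) (j k : nat) (l : seq nat) : bool :=
  has (fun i => (stage S (take i l) == j) && (nth 0%N l i == k))
      (iota 0 (size l)).

Definition nst (S : staged_tree) (N : seq nat -> nat) (j k : nat) : nat :=
  \sum_(l <- paths S | through_edge S j k l) N l.

Definition nbar (S : staged_tree) (N : seq nat -> nat) (j : nat) : nat :=
  \sum_(k < rst S j) nst S N j k.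

Definition BD (S : staged_tree) (N : seq nat -> nat) (alph : nat -> nat -> R)
  : R :=
  \prod_(j <- stages S)
    ((Gamma (\sum_(k < rst S j) alph j k)
       / Gamma (\sum_(k < rst S j) alph j k + (nbar S N j)%:R))
     * \prod_(k < rst S j)
         (Gamma (alph j k + (nst S N j k)%:R) / Gamma (alph j k))).

Definition n_paths_edge (S : staged_tree) (a : seq nat) (k : nat) : nat :=
  count (fun l => prefix (rcons a k) l) (paths S).

Definition alpha_epu (S : staged_tree) (alpha : R) (j k : nat) : R :=
  alpha / (size (paths S))%:R *
  (\sum_(a <- stage_sits S j) n_paths_edge S a k)%:R.

Definition BDepu (S : staged_tree) (N : seq nat -> nat) (alpha : R) : R :=
  BD S N (alpha_epu S alpha).

(* Main.v *)
Require Import Defs.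
From Stdlib Require Import Reals Lra.
From mathcomp Require Import all_boot all_order all_algebra.
From mathcomp Require Import Rstruct.
From Coquelicot Require Import Rbar Lim_seq.

Set Implicit Arguments.
Unset Strict Implicit.
Unset Printing Implicit Defensive.

Import Order.TTheory GRing.Theory Num.Theory.
Local Open Scope ring_scope.

(** Let [A_jk] be the set of paths through the [k]-th edge of stage [j] and
    [A_j] the union of the [A_jk] over [k].  The BDepu score is the product of
    [f A_jk] over all [j], [k] divided by the product of [f A_j] over all [j],
    where [f A = Gamma (c |A| + N(A)) / Gamma (c |A|)] and [c = alpha / |Lambda|].
    It therefore suffices that the formal difference of the multisets [{A_jk}]
    and [{A_j}] depends on the model only.

    For positive integer path weights [u], the likelihood [prod_l p_l^(u_l)] has
    on the model the unique maximiser whose value at [l] is the product of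
    [u(A_jk) / u(A_j)] over the [(j, k)] with [l \in A_jk], so this rational
    function of [u] is an invariant of the model.  Let [p] be a prime larger than
    the number of paths and let [u] be [p] on [B] and [1] off [B]: then [p]
    divides [u(A)] exactly once if [A] is contained in [B] and not at all
    otherwise.  Comparing [p]-adic valuations for all [B] and inverting over the
    subset lattice recovers the multisets. *)

(** * Positivity of Gamma *)

(** Gauss's product, whose limit defines [Gamma]. *)
Definition Gamma_seq (s : R) (n : nat) :=
  ((n`!)%:R * Rpower (n%:R) s) / \prod_(i < n.+1) (s + i%:R).

Lemma prod_shift_gt0 (s : R) (n : nat) : 0 < s -> 0 < \prod_(i < n) (s + i%:R).
Proof. by move=> s0; apply: prodr_gt0 => i _; rewrite ltr_wpDr. Qed.

Lemma Gamma_seq_gt0 (s : R) (n : nat) : 0 < s -> 0 < Gamma_seq s n.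
Proof.
move=> s0; rewrite divr_gt0 ?prod_shift_gt0 // mulr_gt0 ?ltr0n ?fact_gt0 //.
exact/RltP/exp_pos.
Qed.

(** The ratio of consecutive terms, cross-multiplied so that logarithms turn it into a linear
    relation. *)
Lemma Gamma_seqS (s : R) (n : nat) : 0 < s ->
  Gamma_seq s n.+1 * (s + n.+1%:R) * Rpower n%:R s =
  Gamma_seq s n * n.+1%:R * Rpower n.+1%:R s.
Proof.
move=> s0; rewrite /Gamma_seq factS natrM [in LHS]big_ord_recr /=.
have P0 := lt0r_neq0 (prod_shift_gt0 n.+1 s0).
have s1 : s + n.+1%:R != 0 by rewrite lt0r_neq0 // ltr_wpDr.
by rewrite invfM !mulrA mulfVK // [LHS](ACl (2*5*4*1*3)).
Qed.

Section LogBounds.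
Local Open Scope R_scope.

Lemma ln_lt_sub1 (x : R) : 0 < x -> x <> 1 -> ln x < x - 1.
Proof.
move=> x0 x1; have lnx0 : ln x <> 0.
  by move=> lnx; apply: x1; rewrite -(exp_ln _ x0) lnx exp_0.
by have := exp_ineq1 _ lnx0; rewrite exp_ln //; lra.
Qed.

Lemma ln_le_sub1 (x : R) : 0 < x -> ln x <= x - 1.
Proof.
move=> x0; have [->|/ln_lt_sub1] := Req_dec x 1; first by rewrite ln_1; lra.
by move=> /(_ x0); lra.
Qed.

Lemma sub_inv_le_ln (x : R) : 0 < x -> 1 - / x <= ln x.
Proof.
move=> x0; have := ln_le_sub1 (Rinv_0_lt_compat _ x0).
by rewrite ln_Rinv //; lra.
Qed.

Lemma ln_Gamma_seqS (s : R) (n : nat) : 0 < s ->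
  ln (Gamma_seq s n.+2) =
  ln (Gamma_seq s n.+1) + s * ln (INR n.+2 / INR n.+1)
     - ln ((s + INR n.+2) / INR n.+2).
Proof.
move=> s0; have /RltP s0' := s0.
have n1 := lt_0_INR n.+1 (Nat.lt_0_succ n).
have n2 := lt_0_INR n.+2 (Nat.lt_0_succ n.+1).
have /RltP g1 := Gamma_seq_gt0 n.+1 s0'.
have /RltP g2 := Gamma_seq_gt0 n.+2 s0'.
have := f_equal ln (Gamma_seqS n.+1 s0').
rewrite -!INRE -!RmultE -!RplusE.
move: (Gamma_seq s n.+1) (Gamma_seq s n.+2) g1 g2 => x1 x2 g1 g2.
have p1 : 0 < Rpower (INR n.+1) s by exact: exp_pos.
have p2 : 0 < Rpower (INR n.+2) s by exact: exp_pos.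
have s2 : 0 < s + INR n.+2 by lra.
rewrite !ln_mult //; try by [exact: Rmult_lt_0_compat | exact: Rinv_0_lt_compat].
rewrite !ln_Rinv // /Rpower !ln_exp; lra.
Qed.

(* Since [ln (1 + 1/m) >= 1/(m+1)] and [ln (1 + x) <= x], the Gauss sequence
   increases; since [ln (1 + x) >= x / (1 + x)], the second bound telescopes. *)
Lemma ln_Gamma_seq_step (s : R) (n : nat) : 0 < s ->
  ln (Gamma_seq s n.+1) <= ln (Gamma_seq s n.+2)
  <= ln (Gamma_seq s n.+1) + s * (1 + s) * (/ INR n.+1 - / INR n.+2).
Proof.
move=> s0; rewrite ln_Gamma_seqS //.
have n1 := lt_0_INR n.+1 (Nat.lt_0_succ n).
have := S_INR n.+1; set m := INR n.+1 in n1 *; move=> ->.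
have q1 : 0 < (m + 1) / m by apply: Rdiv_lt_0_compat; lra.
have q2 : 0 < (s + (m + 1)) / (m + 1) by apply: Rdiv_lt_0_compat; lra.
have l1 := Rmult_le_compat_l s _ _ (Rlt_le _ _ s0) (sub_inv_le_ln q1).
have l2 := ln_le_sub1 q2.
have u1 := Rmult_le_compat_l s _ _ (Rlt_le _ _ s0) (ln_le_sub1 q1).
have u2 := sub_inv_le_ln q2.
(* Both sides are [s / (m + 1)]: the lower bound of the added logarithm meets the upper bound of the
   subtracted one. *)
have e1 : s * (1 - / ((m + 1) / m)) = (s + (m + 1)) / (m + 1) - 1.
  by field; lra.
(* The increment is at most [s / m - s / (s + m + 1) = s (1 + s) / (m (s + m + 1))]; replacing
   [s + m + 1] by [m + 1] makes it telescope, at the cost of the last, positive summand. *)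
have e2 : s * (1 + s) * (/ m - / (m + 1)) =
   s * ((m + 1) / m - 1) - (1 - / ((s + (m + 1)) / (m + 1)))
     + s * (1 + s) * s / (m * (m + 1) * (s + m + 1)).
  by field; lra.
have e3 : 0 < s * (1 + s) * s / (m * (m + 1) * (s + m + 1)).
  by apply: Rdiv_lt_0_compat; repeat apply: Rmult_lt_0_compat; lra.
lra.
Qed.

(** From index 1 on the Gauss sequence increases and is bounded, so its limit is at least its
    positive first term. Boundedness is essential: [real] sends an infinite limit to 0. *)
Lemma Gamma_pos (s : R) : 0 < s -> 0 < Gamma s.
Proof.
move=> s0; have /RltP s0' := s0; pose u n := Gamma_seq s n.+1.
have u_gt0 n : 0 < u n by exact/RltP/Gamma_seq_gt0.
have ln_le x y : 0 < x -> 0 < y -> ln x <= ln y -> x <= y.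
  move=> x0 y0 [/ln_lt_inv|/ln_inv] h; first by left; apply: h.
  by right; apply: h.
have u_incr n : u n <= u n.+1.
  by apply: ln_le => //; have := ln_Gamma_seq_step n s0; rewrite /u; lra.
have u_le n : ln (u n) <= ln (u 0%N) + s * (1 + s) * (1 - / INR n.+1).
  elim: n => [|n IHn]; first by rewrite INR_1 Rinv_1; lra.
  by have := ln_Gamma_seq_step n s0; rewrite -/(u n) -/(u n.+1); lra.
have [l ul] : ex_finite_lim_seq u.
  apply: (ex_finite_lim_seq_incr u (exp (ln (u 0%N) + s * (1 + s)))) => // n.
  apply: ln_le => //; first exact: exp_pos.
  rewrite ln_exp; have := u_le n.
  have := Rinv_0_lt_compat _ (lt_0_INR n.+1 (Nat.lt_0_succ n)).
  have : 0 < s * (1 + s) by apply: Rmult_lt_0_compat; lra.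
  by nra.
have -> : Gamma s = l.
  by rewrite /Gamma -Lim_seq_incr_1 (is_lim_seq_unique _ _ ul).
exact: Rlt_le_trans (u_gt0 0%N) (is_lim_seq_incr_compare _ _ ul u_incr 0%N).
Qed.

End LogBounds.

(** * Maximum likelihood estimates *)

Lemma ln_prodr (I : eqType) (s : seq I) (P : pred I) (F : I -> R) :
  {in s, forall i, P i -> 0 < F i} ->
  ln (\prod_(i <- s | P i) F i) = \sum_(i <- s | P i) ln (F i).
Proof.
elim: s => [|i s IHs] F0; first by rewrite !big_nil ln_1.
have F0s : {in s, forall i, P i -> 0 < F i}.
  by move=> i' si'; apply: F0; rewrite inE si' orbT.
rewrite !big_cons; case: ifP => [Pi|_]; last exact: IHs.
rewrite -IHs // -RmultE ln_mult //; apply/RltP; first by rewrite F0 ?mem_head.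
by rewrite big_seq_cond; apply: prodr_gt0 => i' /andP[]; exact: F0s.
Qed.

(** Each [y (x/y - 1 - ln (x/y))] is nonnegative and vanishes only for [x = y]; as the total masses
    agree, these terms sum to the difference of the two sides. *)
Lemma gibbs (I : finType) (x y : I -> R) :
  (forall i, 0 < x i) -> (forall i, 0 < y i) -> \sum_i x i = \sum_i y i ->
  \sum_i y i * ln (x i) <= \sum_i y i * ln (y i) /\
  (\sum_i y i * ln (x i) = \sum_i y i * ln (y i) -> x =1 y).
Proof.
move=> x0 y0 xy; pose d i := y i * (x i / y i - 1 - ln (x i / y i)%R).
have r0 i : Rlt 0 (x i / y i)%R by apply/RltP; rewrite divr_gt0.
have d0 i : 0 <= d i.
  by rewrite mulr_ge0 ?(ltW (y0 i)) // subr_ge0; apply/RleP/ln_le_sub1.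
have sum_d : \sum_i d i = \sum_i y i * ln (y i) - \sum_i y i * ln (x i).
  have dE i : d i = (x i - y i) + (y i * ln (y i) - y i * ln (x i)).
    rewrite /d mulrBr mulrBr mulr1 mulrCA mulfV ?lt0r_neq0 // mulr1.
    congr (_ + _); rewrite -mulrBr -mulrN; congr (_ * _).
    rewrite -RmultE -RinvE ln_mult; [|exact/RltP|exact/Rinv_0_lt_compat/RltP].
    by rewrite ln_Rinv ?RplusE ?RoppE ?opprD ?opprK 1?addrC //; apply/RltP.
  under eq_bigr => i _ do rewrite dE.
  by rewrite big_split /= !sumrB xy subrr add0r.
split=> [|eq_ln i]; first by rewrite -subr_ge0 -sum_d sumr_ge0.
have /psumr_eq0P : \sum_i d i = 0 by rewrite sum_d eq_ln subrr.
move=> /(_ (fun i _ => d0 i)) /(_ i isT) /eqP.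
rewrite mulf_eq0 (gt_eqF (y0 i)) /= subr_eq0 => /eqP eq_ln_i.
apply/eqP; rewrite -[y i]mul1r -(can2_eq (mulfVK _) (mulfK _)) ?lt0r_neq0 //.
apply/eqP; have [//|/(ln_lt_sub1 (r0 i))] := Req_dec (x i / y i)%R 1.
by rewrite RminusE eq_ln_i => /RltP; rewrite ltxx.
Qed.

(* The probabilistic content of a staged tree: [cell j k] is the set of paths
   through the [k]-th edge of stage [j]. *)
Record horn (T : finType) := Horn {
  idx : seq nat;
  arity : nat -> nat;
  cell : nat -> nat -> {set T};
  arity_gt0 : forall j, j \in idx -> (0 < arity j)%N;
  cell_neq0 : forall j k, j \in idx -> (k < arity j)%N -> cell j k != set0;
  cell_inj : forall j k k' x, x \in cell j k -> x \in cell j k' -> k = k' }.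

Definition block (T : finType) (H : horn T) (j : nat) : {set T} :=
  \bigcup_(k < arity H j) cell H j k.

Definition horn_valid (T : finType) (H : horn T) (theta : nat -> nat -> R) :=
  forall j, j \in idx H ->
    (forall k, (k < arity H j)%N -> 0 < theta j k) /\
    \sum_(k < arity H j) theta j k = 1.

Definition horn_prob (T : finType) (H : horn T) (theta : nat -> nat -> R)
    (x : T) :=
  \prod_(j <- idx H) \prod_(k < arity H j | x \in cell H j k) theta j k.

Definition weight (T : finType) (u : T -> nat) (A : {set T}) : nat :=
  \sum_(x in A) u x.

Definition horn_mle (T : finType) (H : horn T) (u : T -> nat) (j k : nat) : R :=
  (weight u (cell H j k))%:R / (weight u (block H j))%:R.

(** By [cell_inj] the cells of one stage are pairwise disjoint. *)
Lemma big_block (T : finType) (H : horn T) (j : nat) (V : Type) (e : V)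
    (op : Monoid.com_law e) (F : T -> V) :
  \big[op/e]_(x in block H j) F x =
  \big[op/e]_(k < arity H j) \big[op/e]_(x in cell H j k) F x.
Proof.
apply: partition_disjoint_bigcup => k k' kk'.
rewrite -setI_eq0; apply/eqP/setP => x; rewrite !inE.
apply/andP => -[xk xk']; case/eqP: kk'; apply: val_inj; exact: cell_inj xk xk'.
Qed.

Lemma weight_gt0 (T : finType) (u : T -> nat) (A : {set T}) :
  (forall x, 0 < u x)%N -> A != set0 -> (0 < weight u A)%N.
Proof.
by move=> u0 /set0Pn[x xA]; rewrite /weight (bigD1 x) //= ltn_addr.
Qed.

Lemma cell_sub_block (T : finType) (H : horn T) (j k : nat) :
  (k < arity H j)%N -> cell H j k \subset block H j.
Proof. by move=> lt_k; rewrite -[k]/(val (Ordinal lt_k)) bigcup_sup. Qed.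

Lemma block_neq0 (T : finType) (H : horn T) (j : nat) :
  j \in idx H -> block H j != set0.
Proof.
move=> jH; have lt0 := arity_gt0 jH.
have /set0Pn[x xc] := cell_neq0 jH lt0.
by apply/set0Pn; exists x; apply: (subsetP (cell_sub_block lt0)).
Qed.

Lemma horn_mle_valid (T : finType) (H : horn T) (u : T -> nat) :
  (forall x, 0 < u x)%N -> horn_valid H (horn_mle H u).
Proof.
move=> u0 j jH; have b0 := weight_gt0 u0 (block_neq0 jH); split=> [k lt_k|].
  by rewrite divr_gt0 ?ltr0n // weight_gt0 // cell_neq0.
rewrite -mulr_suml -natr_sum -[(\sum_(k < _) _)%N]big_block divff //.
by rewrite pnatr_eq0 -lt0n.
Qed.

(** Each [ln (theta j k)] is collected once per point of its cell, so the log-likelihood decouples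
    into independent sums, one per stage. *)
Lemma horn_loglik (T : finType) (H : horn T) (theta : nat -> nat -> R)
    (u : T -> nat) :
  horn_valid H theta ->
  \sum_x (u x)%:R * ln (horn_prob H theta x) =
  \sum_(j <- idx H) \sum_(k < arity H j)
    (weight u (cell H j k))%:R * ln (theta j k).
Proof.
move=> vth.
have lnE x : ln (horn_prob H theta x) =
    \sum_(j <- idx H) \sum_(k < arity H j | x \in cell H j k) ln (theta j k).
  rewrite ln_prodr => [|j /vth[th0 _] _]; last by apply: prodr_gt0 => k _; apply: th0.
  by apply: eq_big_seq => j /vth[th0 _]; rewrite ln_prodr // => k _ _; apply: th0.
under eq_bigr => x _ do rewrite lnE mulr_sumr.
rewrite exchange_big; apply: eq_bigr => j _.
under eq_bigr => x _ do rewrite mulr_sumr.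
rewrite (exchange_big_dep xpredT) //=; apply: eq_bigr => k _.
by rewrite natr_sum mulr_suml.
Qed.

(** After decoupling, [gibbs] maximises every stage separately. Equality of the totals forces
    equality in each stage, since no stage can exceed its maximum. *)
Lemma horn_mle_max (T : finType) (H : horn T) (theta : nat -> nat -> R)
    (u : T -> nat) :
  (forall x, 0 < u x)%N -> horn_valid H theta ->
  let lik theta' := \sum_x (u x)%:R * ln (horn_prob H theta' x) in
  lik theta <= lik (horn_mle H u) /\
  (lik theta = lik (horn_mle H u) ->
     horn_prob H theta =1 horn_prob H (horn_mle H u)).
Proof.
move=> u0 vth lik; have vmle := horn_mle_valid (H := H) u0.
rewrite /lik !horn_loglik //.
pose L (eta : nat -> nat -> R) j :=
  \sum_(k < arity H j) (weight u (cell H j k))%:R * ln (eta j k).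
have stage_max j : j \in idx H -> L theta j <= L (horn_mle H u) j /\
    (L theta j = L (horn_mle H u) j ->
     forall k, (k < arity H j)%N -> theta j k = horn_mle H u j k).
  move=> jH; have [th0 th1] := vth j jH; have [m0 m1] := vmle j jH.
  have b0 : 0 < (weight u (block H j))%:R :> R.
    by rewrite ltr0n weight_gt0 ?block_neq0.
  (* Factoring out the weight of the block turns the weights of the cells into a probability
     vector. *)
  have LE eta : L eta j = (weight u (block H j))%:R *
      \sum_(k < arity H j) horn_mle H u j k * ln (eta j k).
    rewrite mulr_sumr; apply: eq_bigr => k _.
    by rewrite mulrA mulrCA mulfV ?mulr1 // lt0r_neq0.
  have := @gibbs _ (fun k : 'I_(arity H j) => theta j k) (fun k => horn_mle H u j k).
  case=> // [k|k||g1 g2]; rewrite ?th1 ?m1 ?th0 ?m0 //.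
  rewrite !LE ler_pM2l //; split=> // /(mulfI (lt0r_neq0 b0))/g2 h k lt_k.
  exact: (h (Ordinal lt_k)).
split=> [|eq_lik x].
  rewrite big_seq [leRHS]big_seq; apply: ler_sum => j jH.
  by case: (stage_max j jH).
apply: eq_big_seq => j jH; apply: eq_bigr => k _.
have [_] := stage_max j jH; apply; last exact: ltn_ord.
apply/esym/eqP; rewrite -subr_eq0.
have: \sum_(j <- idx H | j \in idx H) (L (horn_mle H u) j - L theta j) == 0.
  by rewrite -big_seq sumrB -eq_lik subrr.
rewrite psumr_eq0 => [/allP/(_ j jH)|j']; first by rewrite jH.
by rewrite subr_ge0 => /stage_max[].
Qed.

(** * Recovering the sets from the estimates *)

Lemma logn_prod_seq (I : eqType) (s : seq I) (F : I -> nat) (p : nat) :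
  {in s, forall i, 0 < F i}%N ->
  logn p (\prod_(i <- s) F i)%N = (\sum_(i <- s) logn p (F i))%N.
Proof.
move=> F0; rewrite big_seq [RHS]big_seq.
suff [] : (0 < \prod_(i <- s | i \in s) F i)%N /\
  logn p (\prod_(i <- s | i \in s) F i) = (\sum_(i <- s | i \in s) logn p (F i))%N by [].
elim/big_rec2: _ => [|i n m /F0 Fi [m0 <-]]; first by rewrite logn1.
by rewrite muln_gt0 Fi m0 lognM.
Qed.

(* Giving weight [p] to the points of [B] and [1] to the others makes the
   [p]-adic valuation of a weight detect inclusion in [B]. *)
Lemma logn_weight (T : finType) (p : nat) (A B : {set T}) :
  prime p -> (#|T| < p)%N -> A != set0 ->
  logn p (weight (fun x => if x \in B then p else 1%N) A) = (A \subset B).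
Proof.
move=> p_pr ltTp A0; have ltp (C : {set T}) : (#|C| < p)%N.
  exact: leq_ltn_trans (max_card _) ltTp.
(* The second summand is below [p], so [p] divides the weight only if [A :\: B] is empty; then it
   does so exactly once, as [0 < #|A| < p]. *)
have -> : weight (fun x => if x \in B then p else 1%N) A =
    (#|A :&: B| * p + #|A :\: B|)%N.
  rewrite /weight (big_setID B) /= -sum_nat_const -sum1_card.
  by congr (_ + _)%N; apply: eq_bigr => x; rewrite !inE => /andP[]; [move=> _ -> | move/negPf->].
have [sAB|nsAB] := boolP (A \subset B).
  have /eqP-> : A :\: B == set0 by rewrite setD_eq0.
  rewrite (setIidPl sAB) cards0 addn0 lognM ?(prime_gt0 p_pr) ?card_gt0 //.
  by rewrite [logn p p]logn_prime // eqxx lognE p_pr card_gt0 A0 gtnNdvd ?card_gt0.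
have D0 : (0 < #|A :\: B|)%N by rewrite card_gt0 setD_eq0.
by rewrite lognE p_pr addn_gt0 D0 orbT dvdn_addr ?dvdn_mull // gtnNdvd.
Qed.

(** The inclusion counts are the zeta transform of the multiplicities on the subset lattice, a
    system that is triangular for inclusion. *)
Lemma count_subset (T : finType) (L : seq {set T}) (B : {set T}) :
  count (fun A : {set T} => A \subset B) L =
  (\sum_(C : {set T} | C \subset B) count_mem C L)%N.
Proof.
under eq_bigr => C _ do rewrite -sum1_count big_mkcond.
rewrite exchange_big /= -sum1_count big_mkcond; apply: eq_bigr => A _.
rewrite -big_mkcondr /=; case: ifP => sAB.
  by rewrite (big_pred1 A) // => C /=; rewrite eq_sym; case: eqP => [->|]; rewrite ?sAB ?andbF.
by rewrite big_pred0 // => C; case: eqP => [<-|_]; rewrite ?andbF ?sAB.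
Qed.

(** The empty set is excluded because its weight 0 would annihilate the product and hide all other
    factors. *)
Lemma perm_eq_weight_prod (T : finType) (L L' : seq {set T}) :
  set0 \notin L -> set0 \notin L' ->
  (forall u : T -> nat, (forall x, 0 < u x)%N ->
     \prod_(A <- L) weight u A = \prod_(A <- L') weight u A)%N ->
  perm_eq L L'.
Proof.
move=> L0 L'0 eqLL'.
have eq_sub (B : {set T}) : count (fun A : {set T} => A \subset B) L =
    count (fun A : {set T} => A \subset B) L'.
  have [p ltTp p_pr] := prime_above #|T|.
  pose u x := if x \in B then p else 1%N.
  have u0 x : (0 < u x)%N by rewrite /u; case: ifP => // _; apply: prime_gt0.
  have lognE (M : seq {set T}) : set0 \notin M ->
      logn p (\prod_(A <- M) weight u A)%N = count (fun A : {set T} => A \subset B) M.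
    move=> M0; have nz A : A \in M -> A != set0 by apply: contraTneq => ->.
    rewrite logn_prod_seq => [|A /nz]; last exact: weight_gt0.
    rewrite -sum1_count [RHS]big_mkcond; apply: eq_big_seq => A /nz A0.
    by rewrite (logn_weight B p_pr ltTp A0); case: ifP.
  by rewrite -!lognE ?eqLL'.
suff eq_mem C : count_mem C L = count_mem C L' by apply/allP => C _; rewrite /= eq_mem.
(* Möbius inversion by induction on the cardinality: the proper subsets of [C] contribute equally to
   both counts and cancel. *)
have [n] := ubnP #|C|; elim: n C => // n IHn C leCn.
have := eq_sub C; rewrite !count_subset (bigD1 C) //= [in RHS](bigD1 C) //=.
rewrite (eq_bigr (fun D => count_mem D L')) => [/addIn //|D /andP[sDC neDC]].
rewrite IHn // -ltnS; apply: leq_trans leCn.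
by rewrite ltnS proper_card // properEneq neDC.
Qed.

(** A sequence rather than a set of sets, because multiplicities matter. *)
Definition cells (T : finType) (H : horn T) : seq {set T} :=
  [seq cell H j k | j <- idx H, k <- index_iota 0 (arity H j)].

Definition blocks (T : finType) (H : horn T) : seq {set T} :=
  [seq block H j | j <- idx H].

Lemma big_cells (T : finType) (H : horn T) (V : Type) (e : V)
    (op : Monoid.com_law e) (P : pred {set T}) (F : {set T} -> V) :
  \big[op/e]_(A <- cells H | P A) F A =
  \big[op/e]_(j <- idx H) \big[op/e]_(k < arity H j | P (cell H j k)) F (cell H j k).
Proof.
rewrite big_mkcond big_allpairs_dep; apply: eq_bigr => j _.
by rewrite big_mkord -big_mkcond.
Qed.

Lemma set0_cells (T : finType) (H : horn T) : set0 \notin cells H.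
Proof.
apply/negP => /allpairsPdep[j [k [jH]]]; rewrite mem_index_iota => /= lt_k.
by move/esym/eqP; rewrite (negPf (cell_neq0 jH lt_k)).
Qed.

Lemma set0_blocks (T : finType) (H : horn T) : set0 \notin blocks H.
Proof.
by apply/negP => /mapP[j jH /esym/eqP]; rewrite (negPf (block_neq0 jH)).
Qed.

(** A point of a block lies in exactly one of its cells, so each stage met by [x] gives one factor
    above and one below. This is a Horn parametrisation: a quotient of products of linear forms in
    [u]. *)
Lemma horn_prob_mle (T : finType) (H : horn T) (u : T -> nat) (x : T) :
  horn_prob H (horn_mle H u) x =
  (\prod_(A <- cells H | x \in A) weight u A)%N%:R /
  (\prod_(A <- blocks H | x \in A) weight u A)%N%:R.
Proof.
rewrite /horn_prob big_cells big_map [X in _ / X%:R]big_mkcond !natr_prod -prodf_div.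
apply: eq_bigr => j _; rewrite big_split /= natr_prod; congr (_ * _).
case: ifPn => [/bigcupP[k _ xk]|nx].
  rewrite (big_pred1 k) // => k' /=; apply/idP/eqP => [xk'|->//].
  exact/val_inj/(cell_inj xk' xk).
rewrite big_pred0 ?invr1 // => k; apply: contraNF nx => xk.
by apply/bigcupP; exists k.
Qed.

Definition horn_sub (T : finType) (H H' : horn T) : Prop :=
  forall theta, horn_valid H theta ->
  exists2 theta', horn_valid H' theta' & horn_prob H theta =1 horn_prob H' theta'.

(** Each estimate also belongs to the other model, so the two maximal likelihoods agree, and
    uniqueness of the maximiser identifies the estimates. *)
Lemma horn_mle_eq (T : finType) (H H' : horn T) (u : T -> nat) :
  horn_sub H H' -> horn_sub H' H -> (forall x, 0 < u x)%N ->
  horn_prob H (horn_mle H u) =1 horn_prob H' (horn_mle H' u).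
Proof.
move=> HH' H'H u0.
have [eta vH' eqH'] := HH' _ (horn_mle_valid (H := H) u0).
have [eta' vH eqH] := H'H _ (horn_mle_valid (H := H') u0).
have [le1 eq1] := horn_mle_max u0 vH.
have [le2 _] := horn_mle_max u0 vH'.
move=> x; rewrite eqH; apply/esym/eq1/le_anti; rewrite le1 /=.
under eq_bigr => y _ do rewrite eqH'.
by under [leRHS]eq_bigr => y _ do rewrite -eqH.
Qed.

(* Only the cells and blocks that contain [x] enter the maximum likelihood
   estimate at [x]; as all of them are nonempty, letting [x] vary recovers the
   whole multiset. *)
Lemma perm_cells_blocks (T : finType) (H H' : horn T) :
  horn_sub H H' -> horn_sub H' H ->
  perm_eq (cells H ++ blocks H') (cells H' ++ blocks H).
Proof.
move=> HH' H'H.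
have n0 (K K' : horn T) : set0 \notin cells K ++ blocks K'.
  by rewrite mem_cat negb_or set0_cells set0_blocks.
have perm_at (x : T) : perm_eq [seq A : {set T} <- cells H ++ blocks H' | x \in A]
                         [seq A : {set T} <- cells H' ++ blocks H | x \in A].
  apply: perm_eq_weight_prod => [||u u0]; try by rewrite mem_filter negb_and n0 orbT.
  (* Clearing denominators moves the blocks of each model next to the cells of the other, whence the
     crossed concatenations. *)
  apply/eqP; rewrite !big_filter !big_cat /= -(eqr_nat R) !natrM -eqr_div.
  - by rewrite -!horn_prob_mle (horn_mle_eq HH' H'H).
  - rewrite pnatr_eq0 -lt0n big_seq_cond prodn_cond_gt0 // => A /andP[Ab _].
    by apply: weight_gt0 => //; apply: contraTneq Ab => ->; apply: set0_blocks.
  rewrite pnatr_eq0 -lt0n big_seq_cond prodn_cond_gt0 // => A /andP[Ab _].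
  by apply: weight_gt0 => //; apply: contraTneq Ab => ->; apply: set0_blocks.
have memE (L : seq {set T}) (C : {set T}) x : x \in C ->
    count_mem C L = count_mem C [seq A : {set T} <- L | x \in A].
  move=> xC; rewrite count_filter; apply: eq_count => A /=.
  by case: eqP => // ->; rewrite xC.
apply/allP => C /= LC.
have /set0Pn[x xC] : C != set0.
  by move: LC; rewrite mem_cat; apply: contraTneq => ->; rewrite negb_or !n0.
by rewrite (memE (cells H ++ _) _ x) // (memE (cells H' ++ _) _ x) // (permP (perm_at x)).
Qed.

Lemma horn_prod_invariant (T : finType) (H H' : horn T) (f : {set T} -> R) :
  horn_sub H H' -> horn_sub H' H -> (forall A, A != set0 -> f A != 0) ->
  \prod_(j <- idx H) ((f (block H j))^-1 * \prod_(k < arity H j) f (cell H j k)) =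
  \prod_(j <- idx H') ((f (block H' j))^-1 * \prod_(k < arity H' j) f (cell H' j k)).
Proof.
move=> HH' H'H f0.
have prodE (K : horn T) : \prod_(j <- idx K)
      ((f (block K j))^-1 * \prod_(k < arity K j) f (cell K j k)) =
    (\prod_(A <- cells K) f A) / \prod_(A <- blocks K) f A.
  by rewrite big_split /= prodfV big_cells big_map mulrC.
have blocks_neq0 (K : horn T) : \prod_(A <- blocks K) f A != 0.
  rewrite big_seq prodf_seq_neq0; apply/allP => A Ab; rewrite Ab /=; apply: f0.
  by apply: contraTneq Ab => ->; apply: set0_blocks.
rewrite !prodE; apply/eqP; rewrite eqr_div // -!big_cat /=.
by rewrite (perm_big _ (perm_cells_blocks HH' H'H)).
Qed.

(** * Event trees and stages *)

(** Names the inner fixpoint of [nodes], so that induction can vary the first label [i]. *)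
Fixpoint forest_nodes (i : nat) (cs : seq tree) : seq (seq nat) :=
  if cs is c :: cs' then [seq i :: a | a <- nodes c] ++ forest_nodes i.+1 cs'
  else [::].

Lemma nodesE (cs : seq tree) : nodes (Node cs) = [::] :: forest_nodes 0 cs.
Proof. by rewrite /=; congr cons; elim: cs 0%N => //= c cs IHcs i; rewrite IHcs. Qed.

(** Counting gives membership and absence of repetitions at once; siblings do not interfere because
    their addresses start with different labels. *)
Lemma count_mem_nodes (t : tree) (a : seq nat) :
  count_mem a (nodes t) = isSome (subt t a).
Proof.
elim: a t => [|k a IHa] [cs]; rewrite nodesE /=.
  rewrite -[RHS]addn0; congr (_ + _)%N; elim: cs {1}0%N => //= c cs IHcs i.
  by rewrite count_cat IHcs addn0 count_map (eq_count (a2 := pred0)) ?count_pred0.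
suff H d i : count_mem (k :: a) (forest_nodes i cs) =
    if (i <= k < i + size cs)%N then (isSome (subt (nth d cs (k - i)) a) : nat) else 0%N.
  by rewrite (H (Node cs)) leq0n add0n subn0 /=; case: ltnP.
elim: cs i => [|c cs IHcs] i /=; first by rewrite addn0; case: ltngtP.
rewrite count_cat count_map IHcs; have [->|ki] := eqVneq k i.
  rewrite leqnn ltnn addnS ltnS leq_addr subnn /= addn0 -IHa.
  by apply: eq_count => b /=; rewrite eqseq_cons eqxx.
rewrite (eq_count (a2 := pred0)) ?count_pred0; last first.
  by move=> b /=; rewrite eqseq_cons eq_sym (negPf ki).
rewrite addSnnS add0n; case: (ltngtP k i) ki => //= lt_ik _.
by rewrite -(subnSK lt_ik).
Qed.

Lemma nodes_uniq (t : tree) : uniq (nodes t).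
Proof.
apply: count_mem_uniq => a; rewrite -has_pred1 has_count count_mem_nodes.
by case: isSome.
Qed.

Lemma mem_nodes (t : tree) (a : seq nat) : (a \in nodes t) = isSome (subt t a).
Proof. by rewrite -has_pred1 has_count count_mem_nodes; case: isSome. Qed.

Lemma subt_cat (t : tree) (a b : seq nat) :
  subt t (a ++ b) = obind (subt^~ b) (subt t a).
Proof. by elim: a t => [|k a IHa] [cs] //=; case: ifP. Qed.

Lemma subt_rcons (t : tree) (a : seq nat) (k : nat) :
  isSome (subt t (rcons a k)) = (k < nch t a)%N.
Proof.
rewrite -cats1 subt_cat /nch; case: (subt t a) => [[cs]|] //=.
by case: ifP.
Qed.

Fixpoint first_leaf (t : tree) : seq nat :=
  if t is Node (c :: _) then 0%N :: first_leaf c else [::].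

Lemma subt_first_leaf (t : tree) : subt t (first_leaf t) = Some (Node [::]).
Proof.
move: t; fix IHt 1; case=> [[|c cs]] //=; exact: IHt.
Qed.

(** From the node, keep descending to the first child. *)
Lemma leaf_below (t : tree) (a : seq nat) :
  a \in nodes t -> exists2 l, l \in leaves t & prefix a l.
Proof.
rewrite mem_nodes; case Ea: (subt t a) => [s|//] _.
have Es : subt t (a ++ first_leaf s) = Some (Node [::]).
  by rewrite subt_cat Ea /= subt_first_leaf.
exists (a ++ first_leaf s); last exact: prefix_prefix.
by rewrite mem_filter mem_nodes /nch Es.
Qed.

Lemma leaf_step (t : tree) (l : seq nat) (i : nat) :
  l \in leaves t -> (i < size l)%N ->
  take i l \in situations t /\ (nth 0%N l i < nch t (take i l))%N.
Proof.
rewrite mem_filter mem_nodes => /andP[_ tl] lt_il.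
have lt_nch : (nth 0%N l i < nch t (take i l))%N.
  rewrite -subt_rcons -take_nth //.
  by move: tl; rewrite -{1}(cat_take_drop i.+1 l) subt_cat; case: (subt t _).
split=> //; rewrite mem_filter mem_nodes (leq_ltn_trans _ lt_nch) //=.
by move: lt_nch; rewrite /nch; case: (subt t _).
Qed.

Lemma paths_uniq (S : staged_tree) : uniq (paths S).
Proof. exact/filter_uniq/nodes_uniq. Qed.

Lemma stage_sits_uniq (S : staged_tree) (j : nat) : uniq (stage_sits S j).
Proof. exact/filter_uniq/filter_uniq/nodes_uniq. Qed.

Lemma nch_stage_sits (S : staged_tree) (j : nat) (a : seq nat) :
  is_staged S -> a \in stage_sits S j -> nch (stree S) a = rst S j.
Proof.
move=> stS aj; rewrite /rst.
have: nth [::] (stage_sits S j) 0 \in stage_sits S j.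
  by apply: mem_nth; case: (stage_sits S j) aj.
move: aj; rewrite mem_filter => /andP[/eqP aj sa]; rewrite mem_filter.
by case/andP=> /eqP bj sb; apply: stS => //; rewrite aj bj.
Qed.

Lemma mem_stages (S : staged_tree) (j : nat) :
  j \in stages S -> exists a, a \in stage_sits S j.
Proof.
by rewrite mem_undup => /mapP[a sa ->]; exists a; rewrite mem_filter eqxx.
Qed.

Lemma rst_gt0 (S : staged_tree) (j : nat) :
  is_staged S -> j \in stages S -> (0 < rst S j)%N.
Proof.
move=> stS /mem_stages[a aj]; rewrite -(nch_stage_sits stS aj).
by move: aj; rewrite !mem_filter => /and3P[].
Qed.

Lemma path_step (S : staged_tree) (l : seq nat) (i : nat) :
  is_staged S -> l \in paths S -> (i < size l)%N ->
  [/\ take i l \in stage_sits S (stage S (take i l)),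
      stage S (take i l) \in stages S &
      (nth 0%N l i < rst S (stage S (take i l)))%N].
Proof.
move=> stS /leaf_step step /step[sl lt_l].
have ss : take i l \in stage_sits S (stage S (take i l)).
  by rewrite mem_filter eqxx.
by split; rewrite -?(nch_stage_sits stS ss) // mem_undup map_f.
Qed.

Lemma through_edgeP (S : staged_tree) (j k : nat) (l : seq nat) :
  reflect (exists i, [/\ (i < size l)%N, stage S (take i l) = j & nth 0%N l i = k])
          (through_edge S j k l).
Proof.
apply: (iffP hasP) => [[i]|[i [lt_il <- <-]]].
  by rewrite mem_iota => /= lt_il /andP[/eqP ? /eqP ?]; exists i.
by exists i; rewrite ?mem_iota // !eqxx.
Qed.

Lemma square_free_inj (S : staged_tree) (l : seq nat) (i i' : nat) :
  square_free S -> l \in paths S -> (i < size l)%N -> (i' < size l)%N ->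
  stage S (take i l) = stage S (take i' l) -> i = i'.
Proof.
move=> sfS lS lt_il lt_i'l eq_st; case: (ltngtP i i') => // lt_ii'.
  by have:= sfS l lS _ _ lt_ii' lt_i'l; rewrite eq_st eqxx.
by have:= sfS l lS _ _ lt_ii' lt_il; rewrite eq_st eqxx.
Qed.

Lemma through_edge_inj (S : staged_tree) (j k k' : nat) (l : seq nat) :
  square_free S -> l \in paths S ->
  through_edge S j k l -> through_edge S j k' l -> k = k'.
Proof.
move=> sfS lS /through_edgeP[i [lt_il ij <-]] /through_edgeP[i' [lt_i'l i'j <-]].
by congr nth; apply: square_free_inj sfS lS _ _ _; rewrite ?ij.
Qed.

(** Provides nonempty cells: take any leaf below the [k]-th child of a situation of the stage. *)
Lemma through_edge_ex (S : staged_tree) (j k : nat) :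
  is_staged S -> j \in stages S -> (k < rst S j)%N ->
  exists2 l, l \in paths S & through_edge S j k l.
Proof.
move=> stS /mem_stages[a aj] lt_k.
have /leaf_below[l lS pre_l] : rcons a k \in nodes (stree S).
  by rewrite mem_nodes subt_rcons (nch_stage_sits stS aj).
exists l => //; case/prefixP: pre_l => b ->; apply/through_edgeP; exists (size a).
rewrite size_cat size_rcons addSn ltnS leq_addr cat_rcons take_size_cat //.
by rewrite nth_cat ltnn subnn; split=> //; move: aj; rewrite mem_filter => /andP[/eqP].
Qed.

(** The steps of the path are regrouped by stage and label; by square-freeness each pair occurs at
    most once, so no power of [theta j k] arises. *)
Lemma path_probE (S : staged_tree) (theta : nat -> nat -> R) (l : seq nat) :
  is_staged S -> square_free S -> l \in paths S ->
  path_prob S theta l =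
    \prod_(j <- stages S) \prod_(k < rst S j | through_edge S j k l) theta j k.
Proof.
move=> stS sfS lS; rewrite /path_prob.
pose st (i : 'I_(size l)) := stage S (take i l).
rewrite (eq_bigr (fun i => \prod_(j <- stages S | st i == j)
    theta j (nth 0%N l i))); last first.
  move=> i _; have [_ stl _] := path_step stS lS (ltn_ord i).
  by rewrite -big_filter (@eq_filter _ _ (pred1 (st i))) ?filter_pred1_uniq
    ?undup_uniq ?big_seq1 // => j; rewrite /= eq_sym.
rewrite (exchange_big_dep xpredT) //=; apply: eq_big_seq => j jS.
(* The default of [insubd] is never taken: at a step in stage [j] the label is below [rst S j]. *)
rewrite (partition_big (fun i : 'I_(size l) =>
    insubd (Ordinal (rst_gt0 stS jS)) (nth 0%N l i))
  (fun k : 'I_(rst S j) => through_edge S j k l)); last first.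
  move=> i /eqP ij; have [_ _] := path_step stS lS (ltn_ord i).
  rewrite -/(st i) ij => lt_r; apply/through_edgeP; exists i; split=> //.
  by rewrite val_insubd lt_r.
apply: eq_bigr => k /through_edgeP[i [lt_il ij ik]].
rewrite (big_pred1 (Ordinal lt_il)) => [|i' /=]; first by rewrite ik.
apply/andP/eqP => [[/eqP i'j _]|->].
  by apply: val_inj => /=; apply: square_free_inj sfS lS _ _ _; rewrite ?ij.
split; first exact/eqP.
by apply/eqP/val_inj; rewrite val_insubd /= ik ltn_ord.
Qed.

(** The left side counts pairs of a situation and a path through its [k]-th edge; by square-freeness
    a path occurs in at most one pair. Hence the hyperparameters are proportional to the sizes of
    the cells. *)
Lemma sum_n_paths_edge (S : staged_tree) (j k : nat) :
  is_staged S -> square_free S ->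
  (\sum_(a <- stage_sits S j) n_paths_edge S a k)%N =
  count (through_edge S j k) (paths S).
Proof.
move=> stS sfS.
under eq_bigr => a _ do rewrite /n_paths_edge -sum1_count big_mkcond.
rewrite exchange_big /= -sum1_count [RHS]big_mkcond; apply: eq_big_seq => l lS.
rewrite -big_mkcond sum1_count.
have pre_take a : prefix (rcons a k) l ->
    [/\ (size a < size l)%N, take (size a) l = a & nth 0%N l (size a) = k].
  case/prefixP=> b ->; rewrite size_cat size_rcons addSn ltnS leq_addr.
  by rewrite cat_rcons take_size_cat // nth_cat ltnn subnn.
case: through_edgeP => [[i [lt_il ij ik]]|no_edge].
  rewrite (@eq_in_count _ _ (pred1 (take i l))) => [|a].
    have [mem_i _ _] := path_step stS lS lt_il.
    by rewrite count_uniq_mem ?stage_sits_uniq // -ij mem_i.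
  rewrite mem_filter => /andP[/eqP aj _]; apply/idP/eqP => [/pre_take|->].
    case=> lt_al al _; rewrite -al; congr take.
    by apply: square_free_inj sfS lS _ _ _; rewrite ?al ?aj.
  by rewrite -ik -take_nth // -{2}(cat_take_drop i.+1 l) prefix_prefix.
apply/eqP; rewrite -leqn0 leqNgt -has_count; apply/hasPn => a.
rewrite mem_filter => /andP[/eqP aj _]; apply/negP => /pre_take[lt_al al ak].
by case: no_edge; exists (size a); rewrite al.
Qed.

(** * Score equivalence *)

(** Paths are indexed by [T] through [g], so that the cells of both trees can be subsets of one
    type. *)
Definition tree_cell (S : staged_tree) (T : finType) (g : T -> seq nat)
    (j k : nat) : {set T} :=
  [set x | through_edge S j k (g x)].

Lemma enum_path (S : staged_tree) (T : finType) (g : T -> seq nat) (x : T) :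
  perm_eq (codom g) (paths S) -> g x \in paths S.
Proof. by move=> gS; rewrite -(perm_mem gS) codom_f. Qed.

Lemma tree_cell_neq0 (S : staged_tree) (T : finType) (g : T -> seq nat) :
  is_staged S -> perm_eq (codom g) (paths S) ->
  forall j k, j \in stages S -> (k < rst S j)%N -> tree_cell S g j k != set0.
Proof.
move=> stS gS j k jS lt_k; have [l] := through_edge_ex stS jS lt_k.
rewrite -(perm_mem gS) => /codomP[x ->] thr_x.
by apply/set0Pn; exists x; rewrite inE.
Qed.

Lemma tree_cell_inj (S : staged_tree) (T : finType) (g : T -> seq nat) :
  square_free S -> perm_eq (codom g) (paths S) ->
  forall j k k' x, x \in tree_cell S g j k -> x \in tree_cell S g j k' -> k = k'.
Proof.
move=> sfS gS j k k' x; rewrite !inE.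
exact: through_edge_inj sfS (enum_path x gS).
Qed.

Definition tree_horn (S : staged_tree) (T : finType) (g : T -> seq nat)
    (stS : is_staged S) (sfS : square_free S)
    (gS : perm_eq (codom g) (paths S)) : horn T :=
  Horn (fun j => @rst_gt0 S j stS) (tree_cell_neq0 stS gS)
       (tree_cell_inj sfS gS).

Lemma tree_horn_prob (S : staged_tree) (T : finType) (g : T -> seq nat)
    (stS : is_staged S) (sfS : square_free S)
    (gS : perm_eq (codom g) (paths S)) (theta : nat -> nat -> R) (x : T) :
  horn_prob (tree_horn stS sfS gS) theta x = path_prob S theta (g x).
Proof.
rewrite path_probE //; last exact: enum_path gS.
by apply: eq_bigr => j _; apply: eq_bigl => k; rewrite inE.
Qed.

Lemma sum_paths (S : staged_tree) (T : finType) (g : T -> seq nat)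
    (P : pred (seq nat)) (F : seq nat -> nat) :
  perm_eq (codom g) (paths S) ->
  (\sum_(l <- paths S | P l) F l = \sum_(x | P (g x)) F (g x))%N.
Proof. by move=> gS; rewrite -(perm_big _ gS) /= big_map big_enum_cond. Qed.

(** For [c > 0] and nonempty [A], the rising factorial of [c * #|A|] of length [weight N A]. *)
Definition Gamma_ratio (T : finType) (N : T -> nat) (c : R) (A : {set T}) :=
  Gamma (c * #|A|%:R + (weight N A)%:R)%R / Gamma (c * #|A|%:R)%R.

Lemma Gamma_ratio_neq0 (T : finType) (N : T -> nat) (c : R) (A : {set T}) :
  0 < c -> A != set0 -> Gamma_ratio N c A != 0.
Proof.
move=> c0 A0; have a0 : 0 < c * #|A|%:R by rewrite mulr_gt0 // ltr0n card_gt0.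
apply: lt0r_neq0; rewrite divr_gt0 //; apply/RltP/Gamma_pos/RltP => //.
by rewrite ltr_wpDr.
Qed.

(** A block is the disjoint union of its cells, so summing hyperparameters and counts over [k] gives
    the same expressions for the block. *)
Lemma BDepuE (S : staged_tree) (T : finType) (g : T -> seq nat)
    (stS : is_staged S) (sfS : square_free S)
    (gS : perm_eq (codom g) (paths S)) (N : seq nat -> nat) (M : T -> nat)
    (alpha : R) :
  (forall x, N (g x) = M x) ->
  let H := tree_horn stS sfS gS in
  let f := Gamma_ratio M (alpha / #|T|%:R) in
  BDepu S N alpha =
  \prod_(j <- idx H)
    ((f (block H j))^-1 * \prod_(k < arity H j) f (cell H j k)).
Proof.
move=> NM H f; have sizeS : size (paths S) = #|T|.
  by rewrite -(perm_size gS) size_codom.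
have nstE j k : nst S N j k = weight M (cell H j k).
  by rewrite /nst (sum_paths _ _ gS); apply: eq_big => x; rewrite ?inE ?NM.
have alphaE j k : alpha_epu S alpha j k = alpha / #|T|%:R * #|cell H j k|%:R.
  rewrite /alpha_epu sizeS sum_n_paths_edge // -sum1_count (sum_paths _ _ gS).
  by rewrite sum1dep_card /= cardsE.
apply: eq_bigr => j _.
have -> : \sum_(k < rst S j) alpha_epu S alpha j k =
    alpha / #|T|%:R * #|block H j|%:R.
  under eq_bigr => k _ do rewrite alphaE.
  rewrite -mulr_sumr -natr_sum; congr (_ * _%:R).
  rewrite -sum1_card big_block /=; apply: eq_bigr => k _.
  by rewrite sum1_card.
have -> : nbar S N j = weight M (block H j).
  by rewrite /weight big_block /=; apply: eq_bigr => k _; rewrite nstE.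
rewrite -invf_div; congr (_ * _).
by apply: eq_bigr => k _; rewrite alphaE nstE.
Qed.

Theorem theorem1 (S S' : staged_tree) (phi : seq nat -> seq nat)
  (alpha : R) (N N' : seq nat -> nat) :
  is_staged S -> is_staged S' ->
  square_free S -> square_free S' ->
  stat_equiv S S' phi ->
  0 < alpha ->
  (forall l, l \in paths S -> N' (phi l) = N l) ->
  BDepu S N alpha = BDepu S' N' alpha.
Proof.
move=> stS stS' sfS sfS' [[phi_inj phiS phi_onto] model] alpha0 eqN.
(* Positions in [paths S] index the paths of both trees, by [g] and by [phi \o g]. *)
pose g (x : 'I_(size (paths S))) := nth [::] (paths S) x.
have gS : perm_eq (codom g) (paths S).
  rewrite /codom /image_mem (map_comp (nth [::] (paths S)) val) val_enum_ord.
  by rewrite map_nth_iota0 ?take_size.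
have gS' : perm_eq (codom (phi \o g)) (paths S').
  rewrite /codom /image_mem map_comp (perm_trans (perm_map phi gS)) //.
  apply: uniq_perm; rewrite ?map_inj_in_uniq ?paths_uniq // => l'.
  by apply/mapP/idP => [[l lS ->]|/phi_onto[l lS <-]]; [apply: phiS | exists l].
have lS x : g x \in paths S := enum_path x gS.
rewrite (BDepuE stS sfS gS alpha (fun x => erefl (N (g x)))).
rewrite (BDepuE stS' sfS' gS' alpha (fun x => eqN _ (lS x))).
apply: horn_prod_invariant => [theta vth|theta vth|A].
- have /model[q [[eta [veta q_eta]] p_q]] : in_model S (path_prob S theta).
    by exists theta.
  exists eta => // x; rewrite !tree_horn_prob p_q ?q_eta //=.
  exact: phiS.
- have /model[eta [veta p_eta]] : exists q, in_model S' q /\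
      forall l, l \in paths S -> path_prob S' theta (phi l) = q (phi l).
    by exists (path_prob S' theta); split=> //; exists theta.
  by exists eta => // x; rewrite !tree_horn_prob p_eta.
(* An element of [A] witnesses that the number of paths, the denominator, is positive. *)
move=> A0; apply: Gamma_ratio_neq0 => //; rewrite divr_gt0 // ltr0n.
by case/set0Pn: A0 => x _; apply/card_gt0P; exists x.
Qed.
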